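(* Let $G=(V,E,W)$ be a network with noise-free leader dynamics, and let $S\subseteq V$, $S\neq\emptyset$, be the set of leaders. The coherence of $G$ is $$ R_{NF}(S) = \frac12\sum_{i\in V\setminus S} r(i,S). $$
   Context: $G=(V,E,W)$ is a finite, undirected, connected graph with positive edge weights $w_{ij}$; $W$ is the symmetric weighted adjacency matrix, $D$ the diagonal matrix with entries $\sum_j w_{ij}$, and $L=D-W$ the weighted Laplacian. $S\subseteq V$ is the set of leaders and $V\setminus S$ the set of followers; $L_{ff}$ is the principal submatrix of $L$ indexed by $V\setminus S$ (positive definite when $S\ne\emptyset$). Noise-free leader dynamics: leader states satisfy $\dot x_i=-\kappa_i x_i$ with $\kappa_i>0$, and each follower satisfies $\dot x_i=-\sum_{j\in\mathcal N(i)} w_{ij}(x_i-x_j)+d_i$, where $\mathcal N(i)$ is the neighbor set of $i$ and the $d_i$ are zero-mean, unit-variance white noise processes. The coherence is the total steady-state variance of the followers, which is given by $$R_{NF}(S)=\lim_{t\to\infty}\sum_{i\in V\setminus S}\mathbf E(x_i(t)^2)=\tfrac12\operatorname{tr}(L_{ff}^{-1}).$$ The associated electrical network has node set $V$ and, for each edge $(i,j)$, a resistor of resistance $1/w_{ij}$. For $i\notin S$, $r(i,S)$ is the potential difference between $i$ and $S$ when all nodes of $S$ are held at voltage $0$ and a unit external current is injected at $i$ (leaving through $S$, with no external current at other nodes outside $S$). *)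

(* Defs.v *)
From HB Require Import structures.
From mathcomp Require Import all_boot all_order all_algebra.
From mathcomp Require Import all_classical all_reals all_analysis.

Set Implicit Arguments.
Unset Strict Implicit.
Unset Printing Implicit Defensive.

Import Order.TTheory GRing.Theory Num.Theory.
Import numFieldNormedType.Exports.

Local Open Scope classical_set_scope.
Local Open Scope ring_scope.

Record is_network (R : realType) (V : finType) (E : rel V) (w : V -> V -> R)
    : Prop := IsNetwork {
  network_irrefl : irreflexive E;
  network_sym : symmetric E;
  weight_sym : forall i j, w i j = w j i;
  weight_gt0 : forall i j, E i j -> 0 < w i j;
  weight_nonedge : forall i j, ~~ E i j -> w i j = 0;
  network_connected : forall i j, connect E i j }.

(** White noise has no sample paths, so it enters through its running integrals
    [B i t], the integral of [d_i] over [0, t]. Formally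
    E[d_i(s) d_j(t)] = delta_ij delta(s - t), so that
    E[B i s * B j t] = delta_ij min(s, t). Only first and second moments are
    prescribed; independent standard Wiener processes are an instance, but
    Gaussianity is not required. Times [t < 0] are unconstrained here and
    below. *)
Record is_integrated_white_noise (R : realType) (d : measure_display)
    (T : measurableType d) (P : probability T R) (V : finType) (F : {set V})
    (B : V -> R -> {RV P >-> R}) : Prop := IsIntegratedWhiteNoise {
  noise_continuous : forall i, i \in F ->
    {ae P, forall omega,
      {within `[0, +oo[, continuous (fun t : R => B i t omega : R)}};
  noise_mean : forall i (t : R), i \in F -> 0 <= t -> ('E_P[B i t] = 0)%E;
  noise_covariance : forall i j (s t : R),
    i \in F -> j \in F -> 0 <= s -> 0 <= t ->
    covariance P (B i s) (B j t) = (if i == j then Num.min s t else 0)%:E }.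

Arguments is_integrated_white_noise {R d T} P {V} F B.

(** Since the noise is additive, the follower equation
    dx_i/dt = - \sum_(j in N(i)) w_ij (x_i - x_j) + d_i
    is read pathwise in integrated form, without a stochastic integral. *)
Record is_noise_free_leader_dynamics (R : realType) (d : measure_display)
    (T : measurableType d) (P : probability T R) (V : finType) (E : rel V)
    (w : V -> V -> R) (S : {set V}) (kappa : V -> R)
    (B x : V -> R -> {RV P >-> R}) : Prop := IsNoiseFreeLeaderDynamics {
  leader_rate_gt0 : forall i, i \in S -> 0 < kappa i;
  dynamics_noise : is_integrated_white_noise P (~: S)%SET B;
  initial_second_moment : forall i,
    ('E_P[fun omega => (x i 0 omega ^+ 2)%R] < +oo)%E;
  state_continuous : forall i,
    {ae P, forall omega,
      {within `[0, +oo[, continuous (fun t : R => x i t omega : R)}};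
  leader_equation : forall i, i \in S ->
    {ae P, forall omega, forall t : R, 0 < t ->
      is_derive t (1 : R) (fun s : R => x i s omega : R) (- kappa i * x i t omega)};
  follower_equation : forall i, i \notin S ->
    {ae P, forall omega, forall t : R, 0 <= t ->
      x i t omega = x i 0 omega
        + \int[lebesgue_measure]_(s in `[0, t])
            (- \sum_(j | E i j) w i j * (x i s omega - x j s omega))
        + B i t omega} }.

Arguments is_noise_free_leader_dynamics {R d T} P {V} E w S kappa B x.

Definition total_follower_variance (R : realType) (d : measure_display)
    (T : measurableType d) (P : probability T R) (V : finType) (S : {set V})
    (x : V -> R -> {RV P >-> R}) (t : R) : \bar R :=
  (\sum_(i | i \notin S) 'E_P[fun omega => (x i t omega ^+ 2)%R])%E.

Arguments total_follower_variance {R d T} P {V} S x t.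

Definition coherence (R : realType) (d : measure_display)
    (T : measurableType d) (P : probability T R) (V : finType) (S : {set V})
    (x : V -> R -> {RV P >-> R}) : \bar R :=
  lim (total_follower_variance P S x t @[t --> +oo]).

Arguments coherence {R d T} P {V} S x.

Definition edge_resistance (R : realType) (V : finType) (w : V -> V -> R)
    (i j : V) : R := 1 / w i j.

(** [v] is the potential when [S] is held at voltage 0 and the external
    currents outside [S] are 1 at [i] and 0 elsewhere (Ohm's and Kirchhoff's
    laws). *)
Record is_unit_current_potential (R : realType) (V : finType) (E : rel V)
    (w : V -> V -> R) (S : {set V}) (i : V) (v : V -> R) : Prop :=
    IsUnitCurrentPotential {
  potential_grounded : forall j, j \in S -> v j = 0;
  potential_kirchhoff : forall k, k \notin S ->
    \sum_(j | E k j) (v k - v j) / edge_resistance w k j = (k == i)%:R }.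

(** For [i] outside a nonempty [S] in a connected network the set below is a
    singleton; [0] is the default value otherwise. *)
Definition effective_resistance (R : realType) (V : finType) (E : rel V)
    (w : V -> V -> R) (S : {set V}) (i : V) : R :=
  xget 0 [set v i | v in [set v | is_unit_current_potential E w S i v]].

(* Main.v *)
Require Import Defs.
From HB Require Import structures.
From mathcomp Require Import all_boot all_order all_algebra.
From mathcomp Require Import all_classical all_reals all_analysis.
From mathcomp Require Import spectral complex measurable_realfun ring lra.

Set Implicit Arguments.
Unset Strict Implicit.
Unset Printing Implicit Defensive.

Import Order.TTheory GRing.Theory Num.Theory.
Import numFieldNormedType.Exports.

Local Open Scope classical_set_scope.
Local Open Scope ring_scope.

(** Let [A] be the Laplacian restricted to the followers. It is symmetric and,
    as the graph is connected and [S] nonempty, positive definite, so there are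
    vectors [phi m], supported on the followers, with
    [A phi m = lam m * phi m], [lam m > 0] and
    [\sum_m phi m i * phi m j = (i == j)%:R] for followers [i] and [j]
    ([follower_modes]).

    Electrical side. The potential for a unit current at [i] is the [i]-th
    column of the inverse of [A], that is
    [\sum_m (phi m i / lam m) * phi m]; at [i] it equals
    [\sum_m phi m i ^+ 2 / lam m] ([effective_resistance_modes]). Hence half
    the sum of the effective resistances is
    [\sum_m (\sum_i phi m i ^+ 2) / (2 * lam m)].

    Stochastic side. By Parseval's identity the total variance is the sum over
    [m] of the second moments of [y = \sum_i phi m i * x i], and since [phi m]
    is an eigenvector each [y] solves a scalar equation
    [dy = - lam * y dt + c dt + db], where [b] has the covariance of a Wiener
    process of rate [q = \sum_i phi m i ^+ 2] and the leader input [c] decays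
    exponentially. The initial value and [c] contribute terms whose second
    moments decay, whatever their correlation with the noise, and
    [\int_0^t e^(-lam (t - s)) db(s)] has second moment
    [q * (1 - e^(-2 lam t)) / (2 * lam)], whence the limit [q / (2 * lam)]
    ([mode_second_moment]).

    The stochastic integral is handled through its left-endpoint sums
    [wiener_sum]. Along almost every path these are eventually close to
    [y t - e^(-lam t) y 0], up to the contribution of [c] ([path_approx]). In
    mean square they form a Cauchy sequence, because increments over disjoint
    cells are uncorrelated ([increment_sum_isometry],
    [wiener_sum_refine_msq]). Fatou's lemma combines the two into a
    mean-square estimate for [y t] ([wiener_sum_msq_limit]). *)

(** * Eigenvectors of the grounded Laplacian *)

(** A unitary matrix diagonalises [A] over the complex numbers. As the
    eigenvalues are real, the real and the imaginary parts of its rows are real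
    eigenvectors; together they form a tight frame (in general not a basis),
    which is the completeness relation in the second conjunct. *)
Lemma eigenframe (R : rcfType) (V : finType) (A : V -> V -> R) :
  (forall i j, A i j = A j i) ->
  exists (I : finType) (lam : I -> R) (v : I -> V -> R),
    (forall m k, \sum_j A k j * v m j = lam m * v m k) /\
    (forall i j, \sum_m v m i * v m j = (i == j)%:R).
Proof.
move=> Asym.
pose C : numClosedFieldType := complex R.
pose M : 'M[C]_#|V| := \matrix_(i, j) (A (enum_val i) (enum_val j))%:C%C.
have Msym : M \is symmetricmx.
  apply/is_hermitianmxP; rewrite expr0 scale1r.
  by apply/matrixP => i j; rewrite !mxE Asym.
have Mreal : M \is a mxOver Num.real.
  by apply/mxOverP => i j; rewrite mxE complex_real eqxx.
have Mherm := realsym_hermsym Msym Mreal.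
pose U := spectralmx M.
have UU : U \is unitarymx := spectral_unitarymx M.
have /orthomx_spectralP ME := hermitian_normalmx Mherm.
pose lam (m : 'I_#|V|) : R := complex.Re (spectral_diag M 0 m).
have lamE m : (lam m)%:C%C = spectral_diag M 0 m.
  have /mxOverP /(_ 0 m) := hermitian_spectral_diag_real Mherm.
  by move=> /RRe_real.
have UM : U *m M = diag_mx (spectral_diag M) *m U.
  transitivity (U *m (invmx U *m diag_mx (spectral_diag M) *m U)).
    by congr (_ *m _).
  by rewrite !mulmxA mulmxV ?mul1mx// spectral_unit.
have eigC (m : 'I_#|V|) k :
    \sum_j (A k j)%:C%C * U m (enum_rank j) = (lam m)%:C%C * U m (enum_rank k).
  have /matrixP /(_ m (enum_rank k)) := UM.
  rewrite mul_diag_mx !mxE lamE => <-.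
  rewrite (reindex_onto (@enum_val V V) enum_rank) /=; last first.
    by move=> j _; rewrite enum_rankK.
  under eq_bigl => j do rewrite enum_valK eqxx.
  by apply: eq_bigr => j _; rewrite !mxE enum_rankK enum_valK mulrC Asym.
pose v (mb : 'I_#|V| * bool) (k : V) : R :=
  if mb.2 then complex.Re (U mb.1 (enum_rank k))
  else complex.Im (U mb.1 (enum_rank k)).
have ReM (a : R) (z : C) : complex.Re (a%:C%C * z) = a * complex.Re z.
  by case: z => x y /=; rewrite mul0r subr0.
have ImM (a : R) (z : C) : complex.Im (a%:C%C * z) = a * complex.Im z.
  by case: z => x y /=; rewrite mul0r addr0.
have Resum (I : finType) (f : I -> C) :
    complex.Re (\sum_i f i) = \sum_i complex.Re (f i).
  apply: (big_morph (@complex.Re R)) => //; by case=> ? ? [].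
have Imsum (I : finType) (f : I -> C) :
    complex.Im (\sum_i f i) = \sum_i complex.Im (f i).
  apply: (big_morph (@complex.Im R)) => //; by case=> ? ? [].
exists ('I_#|V| * bool)%type, (fun mb => lam mb.1), v; split.
  move=> [m b] k; have := eigC m k; rewrite /v; case: b => /=.
    move=> /(congr1 (@complex.Re R)); rewrite ReM Resum => <-.
    by apply: eq_bigr => j _; rewrite ReM.
  move=> /(congr1 (@complex.Im R)); rewrite ImM Imsum => <-.
  by apply: eq_bigr => j _; rewrite ImM.
move=> i j.
have UVU : U^t*%sesqui *m U = 1%:M by rewrite -invmx_unitary// mulVmx// spectral_unit.
have /matrixP /(_ (enum_rank i) (enum_rank j)) := UVU.
rewrite !mxE (inj_eq enum_rank_inj) => /(congr1 (@complex.Re R)).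
rewrite Resum; have -> : complex.Re ((i == j)%:R : C) = (i == j)%:R.
  by case: (i == j).
move=> <-.
rewrite (eq_bigr (fun m => \sum_b v (m, b) i * v (m, b) j)) => [|m _]; last first.
  rewrite !mxE big_bool /v /=.
  by case: (U m (enum_rank i)) => a b; case: (U m (enum_rank j)) => c d /=; ring.
by rewrite pair_bigA; apply: eq_bigr => -[].
Qed.

(** The sum runs over all nodes because the weights of a network vanish off its
    edges. *)
Definition laplacian (R : ringType) (V : finType) (w : V -> V -> R)
  (f : V -> R) (k : V) : R := \sum_j w k j * (f k - f j).

Lemma laplacian_sym (R : comRingType) (V : finType) (w : V -> V -> R)
    (f g : V -> R) : (forall i j, w i j = w j i) ->
  \sum_k f k * laplacian w g k = \sum_k laplacian w f k * g k.
Proof.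
move=> wsym.
have dist (a b : V -> R) : \sum_k a k * laplacian w b k =
    \sum_k \sum_j w k j * a k * b k - \sum_k \sum_j w k j * a k * b j.
  rewrite -sumrB; apply: eq_bigr => k _.
  rewrite -sumrB mulr_sumr; apply: eq_bigr => j _; ring.
under [RHS]eq_bigr do rewrite mulrC.
rewrite !dist; congr (_ - _).
  by apply: eq_bigr => k _; apply: eq_bigr => j _; ring.
rewrite exchange_big; apply: eq_bigr => k _; apply: eq_bigr => j _.
rewrite wsym; ring.
Qed.

Lemma laplacian_energy (R : realFieldType) (V : finType) (w : V -> V -> R)
    (f : V -> R) : (forall i j, w i j = w j i) ->
  \sum_k f k * laplacian w f k
    = 2^-1 * \sum_k \sum_j w k j * (f k - f j) ^+ 2.
Proof.
move=> wsym.
pose D := \sum_k \sum_j w k j * f k * (f k - f j).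
have D1 : \sum_k f k * laplacian w f k = D.
  apply: eq_bigr => k _; rewrite mulr_sumr; apply: eq_bigr => j _; ring.
have D2 : D = \sum_k \sum_j w k j * f j * (f j - f k).
  rewrite /D exchange_big; apply: eq_bigr => k _; apply: eq_bigr => j _.
  by rewrite wsym.
rewrite D1; have -> : \sum_k \sum_j w k j * (f k - f j) ^+ 2 = D + D.
  rewrite {2}D2 -big_split; apply: eq_bigr => k _ /=.
  rewrite -big_split; apply: eq_bigr => j _ /=; ring.
by field.
Qed.

Lemma sum_edges (R : realType) (V : finType) (E : rel V)
    (w : V -> V -> R) (g : V -> R) (k : V) : is_network E w ->
  \sum_(j | E k j) w k j * g j = \sum_j w k j * g j.
Proof.
move=> hG; rewrite [RHS](bigID (E k)) /= [X in _ + X]big1 ?addr0// => j.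
by move=> /(weight_nonedge hG) ->; rewrite mul0r.
Qed.

(** Zero energy makes [f] constant along edges, and every node is joined by a
    path to a node of [S], where [f] vanishes. *)
Lemma grounded_energy_eq0 (R : realType) (V : finType) (E : rel V)
    (w : V -> V -> R) (S : {set V}) (f : V -> R) :
  is_network E w -> S != finset.set0 -> (forall j, j \in S -> f j = 0) ->
  \sum_k f k * laplacian w f k <= 0 -> forall k, f k = 0.
Proof.
move=> hG /set0Pn[s sS] fS.
rewrite (laplacian_energy _ (weight_sym hG)) pmulr_rle0 ?invr_gt0// => le0 k.
have w_ge0 i j : 0 <= w i j.
  have [/(weight_gt0 hG)/ltW//|/(weight_nonedge hG)->//] := boolP (E i j).
have nn i j : 0 <= w i j * (f i - f j) ^+ 2 by rewrite mulr_ge0// sqr_ge0.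
have nns i : 0 <= \sum_j w i j * (f i - f j) ^+ 2.
  by apply: sumr_ge0 => j _.
have step i j : E i j -> f i = f j.
  move=> Eij; have : \sum_k \sum_j w k j * (f k - f j) ^+ 2 == 0.
    by rewrite eq_le le0 sumr_ge0.
  rewrite psumr_eq0// => /allP/(_ i (mem_index_enum _)) /=.
  rewrite psumr_eq0// => /allP/(_ j (mem_index_enum _)) /=.
  rewrite mulf_eq0 gt_eqF ?(weight_gt0 hG)//= sqrf_eq0 subr_eq0.
  by move=> /eqP.
have /connectP[p pth ks] := network_connected hG k s.
elim: p k pth ks => [|a p IH] k /=; first by move=> _ <-; exact: fS.
by move=> /andP[/step -> pth] /(IH _ pth).
Qed.

(** The matrix [A] of the proof is zero on the rows and columns of the leaders,
    so cutting an eigenvector of [A] down to the followers gives an eigenvector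
    for the same value. If it is nonzero this value is positive, by the energy;
    if it is zero the eigenvalue equation holds for any value, and 1 is taken
    so that every [lam m] is positive. *)
Lemma follower_modes (R : realType) (V : finType) (E : rel V)
    (w : V -> V -> R) (S : {set V}) :
  is_network E w -> S != finset.set0 ->
  exists (I : finType) (lam : I -> R) (phi : I -> V -> R),
    [/\ forall m, 0 < lam m,
       forall m j, j \in S -> phi m j = 0,
       forall m k, k \notin S -> laplacian w (phi m) k = lam m * phi m k
     & forall i j, i \notin S -> j \notin S ->
         \sum_m phi m i * phi m j = (i == j)%:R].
Proof.
move=> hG hS.
pose A i j : R := if (i \notin S) && (j \notin S) then
  (i == j)%:R * (\sum_k w i k) - w i j else 0.
have Asym i j : A i j = A j i.
  rewrite /A andbC; case: ifP => // _; rewrite (weight_sym hG i j) eq_sym.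
  by case: eqP => [->//|_]; rewrite !mul0r.
have [I [lam [v [vA v1]]]] := eigenframe Asym.
pose phi m k := if k \in S then 0 else v m k.
have phiS m j : j \in S -> phi m j = 0 by rewrite /phi => ->.
have phiL m k : k \notin S -> laplacian w (phi m) k = lam m * phi m k.
  move=> kS; rewrite {2}/phi (negPf kS) -vA /laplacian.
  under eq_bigr do rewrite mulrBr; rewrite sumrB -mulr_suml.
  have -> : \sum_j A k j * v m j = \sum_j A k j * phi m j.
    by apply: eq_bigr => j _; rewrite /A /phi kS; case: (j \in S); rewrite ?mul0r.
  have -> : \sum_j A k j * phi m j =
      \sum_j (k == j)%:R * (\sum_i w k i) * phi m j - \sum_j w k j * phi m j.
    rewrite -sumrB; apply: eq_bigr => j _; rewrite /A kS /=.
    have [jS|jS] := boolP (j \in S); first by rewrite phiS//; ring.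
    by rewrite mulrBl.
  congr (_ - _); rewrite [RHS](bigD1 k)//= eqxx mul1r [X in _ + X]big1 ?addr0// => j jk.
  by rewrite eq_sym (negPf jk) !mul0r.
exists I, (fun m => if [forall k, phi m k == 0] then 1 else lam m), phi.
split => //.
- move=> m; case: ifP => // /forallP nz; rewrite ltNge; apply/negP => lam0.
  apply: nz => k; apply/eqP; apply: (grounded_energy_eq0 hG hS (phiS m)).
  rewrite -oppr_ge0 -sumrN; apply: sumr_ge0 => j _.
  have [jS|jS] := boolP (j \in S); first by rewrite phiS// mul0r oppr0.
  rewrite phiL// oppr_ge0 mulrCA; apply: mulr_le0_ge0 => //.
  by rewrite -expr2 sqr_ge0.
- move=> m k kS; rewrite phiL//; case: ifP => // /forallP/(_ k)/eqP ->.
  by rewrite !mulr0.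
- move=> i j iS jS; rewrite -v1; apply: eq_bigr => m _.
  by rewrite /phi (negPf iS) (negPf jS).
Qed.

(** The potential [v] below is the [i]-th column of the inverse of the grounded
    Laplacian; two potentials agree because their difference has zero energy. *)
Lemma effective_resistance_modes (R : realType) (V : finType) (E : rel V)
    (w : V -> V -> R) (S : {set V}) (I : finType) (lam : I -> R)
    (phi : I -> V -> R) (i : V) :
  is_network E w -> S != finset.set0 ->
  (forall m, lam m != 0) ->
  (forall m j, j \in S -> phi m j = 0) ->
  (forall m k, k \notin S -> laplacian w (phi m) k = lam m * phi m k) ->
  (forall i j, i \notin S -> j \notin S ->
         \sum_m phi m i * phi m j = (i == j)%:R) ->
  i \notin S ->
  effective_resistance E w S i = \sum_m phi m i ^+ 2 / lam m.
Proof.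
move=> hG hS lam0 phiS phiL phi1 iS.
have kirE v k : \sum_(j | E k j) (v k - v j) / edge_resistance w k j
    = laplacian w v k.
  rewrite /laplacian -(sum_edges (fun j => v k - v j) k hG).
  apply: eq_bigr => j _.
  by rewrite /edge_resistance div1r invrK mulrC.
pose v k := \sum_m phi m i * phi m k / lam m.
have lapv k : laplacian w v k = \sum_m phi m i / lam m * laplacian w (phi m) k.
  rewrite /laplacian; under [RHS]eq_bigr do rewrite mulr_sumr.
  rewrite exchange_big; apply: eq_bigr => j _.
  rewrite /v -sumrB mulr_sumr; apply: eq_bigr => m _; ring.
have vP : is_unit_current_potential E w S i v.
  split=> [j jS|k kS].
    by rewrite /v big1// => m _; rewrite (phiS m j)// mulr0 mul0r.
  rewrite kirE lapv -phi1//.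
  by apply: eq_bigr => m _; rewrite phiL// mulrA divfK// mulrC.
have uniq u : is_unit_current_potential E w S i u -> u i = v i.
  move=> uP; apply/eqP; rewrite -subr_eq0; apply/eqP.
  apply: (grounded_energy_eq0 (f := fun k => u k - v k) hG hS).
    by move=> j jS; rewrite (potential_grounded uP)// (potential_grounded vP)// subr0.
  rewrite big1// => k _.
  have [kS|kS] := boolP (k \in S).
    by rewrite (potential_grounded uP)// (potential_grounded vP)// subr0 mul0r.
  have -> : laplacian w (fun k => u k - v k) k = laplacian w u k - laplacian w v k.
    by rewrite /laplacian -sumrB; apply: eq_bigr => j _; ring.
  by rewrite -!kirE (potential_kirchhoff uP)// (potential_kirchhoff vP)// subrr mulr0.
rewrite /effective_resistance; case: xgetP => [y _ [u uP <-]|/(_ (v i))[]].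
  by rewrite (uniq _ uP) /v; apply: eq_bigr => m _; rewrite expr2.
by exists v.
Qed.

(** * Pathwise approximation of a forced linear equation *)

(** Heine's theorem. *)
Lemma segment_unif_continuous (R : realType) (f : R -> R) (a b : R) :
  {within `[a, b], continuous f} -> forall e, 0 < e ->
  exists2 dlt, 0 < dlt & forall x y, x \in `[a, b] -> y \in `[a, b] ->
    `|x - y| < dlt -> `|f x - f y| < e.
Proof.
move=> /subspace_continuousP fc e e0.
have : \forall d \near 0^'+, `[a, b]%classic `<=` (fun x =>
    forall y, y \in `[a, b] -> `|x - y| < d -> `|f x - f y| < e).
  have /compact_near_coveringP /near_covering_withinP := @segment_compact R a b.
  apply => x abx; have e2 : 0 < e / 2 by rewrite divr_gt0.
  have /cvgrPdist_lt /(_ _ e2) := fc x abx.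
  rewrite near_withinE near_nbhs => /nbhs_ballP[r /= r0 rP].
  have r2 : 0 < r / 2 by rewrite divr_gt0.
  near=> x' d => abx' y aby x'y.
  have xx' : `|x - x'| < r / 2 by near: x'; exact: nbhsx_ballx.
  have dr : d < r / 2 by near: d; exact: nbhs_right_lt.
  have H1 : `|f x - f x'| < e / 2.
    apply: rP => //; rewrite /ball /= (lt_trans xx')// ltr_pdivrMr//.
    by rewrite mulr_natr mulr2n ltrDl.
  have H2 : `|f x - f y| < e / 2.
    apply: rP => //; rewrite /ball /=.
    rewrite -(subrKA x') (le_lt_trans (ler_normD _ _))// (splitr r) ltrD//.
    exact: lt_trans dr.
  rewrite -(subrKA (f x)) (le_lt_trans (ler_normD _ _))// (splitr e) ltrD//.
  by rewrite distrC.
move=> near_d.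
near (0:R)^'+ => d.
exists d => //.
have := near near_d d; move=> H x y abx aby; apply: H => //.
Unshelve. all: by end_near. Qed.

Lemma subset_itv0S (R : realType) (a b : R) : 0 <= a ->
  `[a, b]%classic `<=` `[0, +oo[%classic.
Proof.
by move=> a0 x /=; rewrite !in_itv/= andbT => /andP[/(le_trans a0)].
Qed.


Lemma is_derive_expRM (R : realType) (k b x : R) :
  is_derive x (1 : R) (fun s => expR (k * s + b)) (expR (k * x + b) * k).
Proof.
have d1 : is_derive x (1 : R) (fun s => k * s + b) k.
  have := is_deriveD (is_deriveZ k (is_derive_id x 1)) (is_derive_cst b x 1).
  by rewrite addr0 [_ *: _]mulr1.
exact: (is_derive1_comp (f := expR) (g := fun s => k * s + b)).
Qed.

(** The mean value theorem with integrating factor [expR (k * s + b0)]. The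
    free constant [b] is where [path_approx] puts the value of the noise at the
    right end of a cell. *)
Lemma exp_mvt (R : realType) (k b0 r s b : R) (z dz : R -> R) : r < s ->
  {within `[r, s], continuous z} ->
  (forall x, x \in `]r, s[ -> is_derive x (1 : R) z (dz x)) ->
  exists2 x, x \in `]r, s[ &
    expR (k * s + b0) * (z s + b) - expR (k * r + b0) * (z r + b) =
    expR (k * x + b0) * (k * (z x + b) + dz x) * (s - r).
Proof.
move=> rs cz dzE.
pose f := (fun s => expR (k * s + b0)) * (z + cst b).
have df x : x \in `]r, s[ -> is_derive x (1 : R) f
    (expR (k * x + b0) * (k * (z x + b) + dz x)).
  move=> /dzE dx.
  have := is_deriveM (is_derive_expRM k b0 x)
    (is_deriveD dx (is_derive_cst b x 1)).
  move=> h; apply: (is_derive_eq h).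
  rewrite !fctE /GRing.scale /=; ring.
have cf : {within `[r, s], continuous f}.
  move=> x; apply: cvgM.
    apply: continuous_subspaceT => y.
    apply: differentiable_continuous; apply/derivable1_diffP.
    by have := is_derive_expRM k b0 y; case.
  apply: cvgD; [exact: cz|exact: cvg_cst].
by have [x xrs ->] := MVT rs df cf; exists x.
Qed.

Lemma exp_decay (R : realType) (k : R) (f : R -> R) :
  {within `[0, +oo[, continuous f} ->
  (forall t : R, 0 < t -> is_derive t (1 : R) f (- k * f t)) ->
  forall t, 0 <= t -> f t = expR (- (k * t)) * f 0.
Proof.
move=> cf df t; rewrite le_eqVlt => /predU1P[<-|t0].
  by rewrite mulr0 oppr0 expR0 mul1r.
have [||x _] := @exp_mvt R k 0 0 t 0 f (fun x => - k * f x) t0.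
- by apply: continuous_subspaceW cf; exact: subset_itv0S.
- by move=> x; rewrite in_itv/= => /andP[x0 _]; exact: df.
rewrite !addr0 mulNr subrr !mulr0 mul0r expR0 mul1r => /eqP.
rewrite subr_eq0 => /eqP <-.
by rewrite mulrA -expRD addNr expR0 mul1r.
Qed.

Definition grid (R : realType) (t : R) (n k : nat) : R := t * (k%:R / n%:R).

(** The left-endpoint sum, over [n] equal cells of [0, t], for the Wiener
    integral of [expR (- lam * (t - s))] against [b]. *)
Definition wiener_sum (R : realType) (lam t : R) (b : R -> R) (n : nat) : R :=
  \sum_(0 <= k < n) expR (lam * grid t n k - lam * t) *
    (b (grid t n k.+1) - b (grid t n k)).

Lemma grid0 (R : realType) (t : R) n : grid t n 0 = 0.
Proof. by rewrite /grid mul0r mulr0. Qed.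

Lemma gridn (R : realType) (t : R) n : (0 < n)%N -> grid t n n = t.
Proof. by move=> n0; rewrite /grid divff ?mulr1// pnatr_eq0 -lt0n. Qed.

Lemma gridS (R : realType) (t : R) n k : grid t n k.+1 - grid t n k = t / n%:R.
Proof. by rewrite /grid -mulrBr -mulrBl -natrB ?subSnn ?mul1r. Qed.

Lemma grid_le (R : realType) (t : R) n i j : 0 <= t -> (i <= j)%N ->
  grid t n i <= grid t n j.
Proof.
by move=> t0 ij; rewrite /grid ler_wpM2l// ler_wpM2r ?invr_ge0// ler_nat.
Qed.

Lemma grid_ge0 (R : realType) (t : R) n k : 0 <= t -> 0 <= grid t n k.
Proof. by move=> t0; rewrite -(grid0 t n) grid_le. Qed.

(** Formally [y' = - lam * y + c + b'] with [b] rough. Telescoping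
    [expR (lam * s) * y s] over the cells leaves, on each cell, the variation of
    [expR (lam * s) * ((y - b) s + b p)] with [b] frozen at the right end [p].
    Only the differentiable part [y - b] is then differentiated, and the mean
    value theorem yields [lam * (b p - b x) + c x] for some [x] in the cell: the
    first term is small by uniform continuity, the second is controlled
    by [M]. *)
Lemma path_approx (R : realType) (lam t M : R) (y b c : R -> R) :
  0 < lam -> 0 < t ->
  {within `[0, +oo[, continuous y} -> {within `[0, +oo[, continuous b} ->
  (forall s : R, 0 < s -> is_derive s (1 : R) (y - b) (c s - lam * y s)) ->
  (forall s, 0 < s < t -> expR (lam * s - lam * t) * `|c s| <= M) ->
  forall e, 0 < e -> exists N, forall n, (N <= n)%N ->
    `|y t - expR (- (lam * t)) * y 0 - wiener_sum lam t b n| <= t * M + e.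
Proof.
move=> lam0 t0 cy cb dy cM e e0.
have cz : {within `[0, +oo[, continuous (y - b)}.
  exact: within_continuousB.
have sub (r s : R) : 0 <= r -> `[r, s]%classic `<=` `[0, +oo[%classic.
  exact: subset_itv0S.
have eta0 : 0 < e / (lam * t) by rewrite divr_gt0// mulr_gt0.
have [dlt dlt0 ucb] := segment_unif_continuous
  (continuous_subspaceW (@sub 0 t (lexx 0)) cb) eta0.
(* From this rank on the mesh [t / n] is below the modulus [dlt]. *)
exists (Num.bound (t / dlt)) => n Nn.
have tdn : t / dlt < n%:R.
  rewrite (lt_le_trans (archi_boundP _)) ?ler_nat//.
  by rewrite divr_ge0// ltW.
have n0 : (0 < n)%N.
  by rewrite -(ltr_nat R) (le_lt_trans _ tdn)// divr_ge0// ltW.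
have nR0 : 0 < n%:R :> R by rewrite ltr0n.
have hdlt : t / n%:R < dlt by rewrite ltr_pdivrMr// mulrC -ltr_pdivrMr.
have h0 : 0 < t / n%:R by rewrite divr_gt0.
pose g s := expR (lam * s - lam * t).
pose p k := grid t n k.
have -> : y t - expR (- (lam * t)) * y 0 - wiener_sum lam t b n =
    \sum_(0 <= k < n) (g (p k.+1) * ((y - b) (p k.+1) + b (p k.+1)) -
       g (p k) * ((y - b) (p k) + b (p k.+1))).
  have -> : y t - expR (- (lam * t)) * y 0 =
      \sum_(0 <= k < n) (g (p k.+1) * y (p k.+1) - g (p k) * y (p k)).
    rewrite (telescope_sumr (fun k => g (p k) * y (p k)))// /p /g.
    by rewrite gridn// grid0 subrr expR0 mul1r mulr0 add0r.
  rewrite /wiener_sum -sumrB; apply: eq_bigr => k _.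
  rewrite -/(p k) -/(p k.+1) -/(g (p k)) !fctE; ring.
have -> : t * M + e = \sum_(0 <= k < n) (t / n%:R * (lam * (e / (lam * t)) + M)).
  rewrite sumr_const_nat subn0 -[RHS]mulr_natr.
  by field; rewrite !gt_eqF.
apply: (le_trans (ler_norm_sum _ _ _)); rewrite big_nat [leRHS]big_nat.
apply: ler_sum => k /= kn.
have pk0 : 0 <= p k by rewrite grid_ge0 ?ltW.
have pkt : p k.+1 <= t by rewrite -[leRHS](gridn t n0) grid_le ?ltW.
have pS : p k.+1 - p k = t / n%:R by rewrite gridS.
have pk : p k < p k.+1 by rewrite -subr_gt0 pS.
have [||x] := @exp_mvt R lam (- (lam * t)) (p k) (p k.+1) (b (p k.+1)) (y - b)
  (fun s => c s - lam * y s) pk.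
- exact: (continuous_subspaceW (sub _ _ pk0) cz).
- by move=> x; rewrite in_itv/= => /andP[px _]; apply: dy; rewrite (le_lt_trans pk0).
rewrite in_itv/= => /andP[px xp] ->; rewrite pS.
rewrite normrM [`|t / _|]gtr0_norm// mulrC ler_pM2l//.
have -> : lam * ((y - b) x + b (p k.+1)) + (c x - lam * y x) =
    lam * (b (p k.+1) - b x) + c x by rewrite !fctE; ring.
have x0 : 0 < x by rewrite (le_lt_trans pk0).
have xt : x < t by rewrite (lt_le_trans xp).
rewrite mulrDr (le_trans (ler_normD _ _))// lerD//; last first.
  by rewrite normrM gtr0_norm ?expR_gt0// cM// x0.
rewrite !normrM (gtr0_norm lam0) mulrCA ler_pM2l//.
rewrite -[leRHS]mul1r ler_pM//.
  rewrite ger0_norm ?expR_ge0// -expR0 ler_expR -mulrBr.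
  by rewrite pmulr_rle0// subr_le0 ltW.
apply/ltW/ucb; rewrite ?in_itv/= ?pkt ?(ltW xt) ?(ltW x0) ?andbT//.
  by rewrite (le_trans pk0)// ltW.
rewrite (le_lt_trans _ hdlt)// -pS ger0_norm ?subr_ge0 ?ltW//.
by rewrite ltrD2l ltrN2.
Qed.

(** * Second moments *)

Lemma eventually_le_limn_einf (R : realType) (u : (\bar R)^nat) (a : \bar R) :
  (exists N, forall n, (N <= n)%N -> (a <= u n)%E) -> (a <= limn_einf u)%E.
Proof.
move=> [N uN]; rewrite limn_einf_lim; apply: lime_ge; first exact: is_cvg_einfs.
near=> n; apply: le_ereal_inf_tmp => _ [k /= nk <-]; apply: uN.
by apply: leq_trans nk; near: n; exact: nbhs_infty_ge.
Unshelve. all: by end_near. Qed.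

Lemma limn_einf_le_bound (R : realType) (u : (\bar R)^nat) (K : \bar R) :
  (forall n, (u n <= K)%E) -> (limn_einf u <= K)%E.
Proof.
move=> uK; rewrite limn_einf_lim; apply: lime_le; first exact: is_cvg_einfs.
by apply: nearW => n; apply: (le_trans _ (uK n)); apply: ereal_inf_lbound; exists n => /=.
Qed.

Section second_moments.
Context (R : realType) (d : measure_display) (T : measurableType d)
  (P : probability T R).

(** Fatou's lemma for upper bounds that hold from a rank on which may depend on
    the outcome. *)
Lemma expectation_fatou_le (X : T -> R) (Y : nat -> T -> R) (K : \bar R) :
  measurable_fun setT X -> (forall w, 0 <= X w) ->
  (forall n, measurable_fun setT (Y n)) -> (forall n w, 0 <= Y n w) ->
  {ae P, forall w, exists N, forall n, (N <= n)%N -> X w <= Y n w} ->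
  (forall n, ('E_P[Y n] <= K)%E) -> ('E_P[X] <= K)%E.
Proof.
move=> mX X0 mY Y0 XY EY.
have mEY n := (measurable_EFinP _ _).2 (mY n).
have fat : (\int[P]_w limn_einf (fun n => (Y n w)%:E) <= K)%E.
  apply: (le_trans (fatou P measurableT mEY _)).
    by move=> n w _; rewrite lee_fin.
  by apply: limn_einf_le_bound => n; have := EY n; rewrite unlock.
rewrite unlock; apply: le_trans fat.
apply: ae_ge0_le_integral => //.
- by move=> w _; rewrite lee_fin.
- exact/measurable_EFinP.
- move=> w _; apply: eventually_le_limn_einf; exists 0%N => n _.
  by rewrite lee_fin.
- rewrite /limn_einf; apply: measurableT_comp => //.
  apply: (measurable_fun_limn_esup (f := fun n w => (- (Y n w)%:E)%E)) => n.
  by apply: (measurableT_comp _ (mEY n)); exact: oppe_measurable.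
- apply: filterS XY => w [N XYN] _; apply: eventually_le_limn_einf.
  by exists N => n Nn; rewrite lee_fin XYN.
Qed.

Lemma Lfun2_sqr_lty (X : T -> R) : measurable_fun setT X ->
  ('E_P[fun w => (X w ^+ 2)%R] < +oo)%E -> X \in Lfun P 2%:E.
Proof.
move=> mX; rewrite unlock => EX.
rewrite inE; apply/andP; split; rewrite inE//= /finite_norm unlock.
apply: poweR_lty; apply: le_lt_trans EX.
by under eq_integral => w _ do
  rewrite /= powR_mulrn// -normrX ger0_norm ?sqr_ge0//.
Qed.

Lemma measurable_Lfun2 (X : T -> R) :
  X \in Lfun P 2%:E -> measurable_fun setT X.
Proof. by rewrite inE => /andP[/[!inE]]. Qed.

Lemma expectation_fin_sum (J : finType) (Q : pred J) (X : J -> T -> R) :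
  (forall j, Q j -> X j \in Lfun P 1) ->
  ('E_P[fun w => (\sum_(j | Q j) X j w)%R])%E = (\sum_(j | Q j) 'E_P[X j])%E.
Proof.
move=> X1; have := @expectation_sum _ _ _ P [seq X j | j <- enum Q].
rewrite !big_map !big_enum /= => <-.
  by congr expectation; apply/funext => w; rewrite fct_sumE.
by move=> _ /mapP[j + ->]; rewrite mem_enum => /X1.
Qed.

Lemma expectation_bilinear (J : finType) (Q : pred J) (X Y : J -> T -> R)
    (a b : J -> R) (c : J -> J -> R) :
  (forall j, Q j -> X j \in Lfun P 2%:E) ->
  (forall j, Q j -> Y j \in Lfun P 2%:E) ->
  (forall i j, Q i -> Q j -> ('E_P[(X i * Y j)%R] = (c i j)%:E)%E) ->
  ('E_P[fun w => ((\sum_(i | Q i) a i * X i w) *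
      (\sum_(j | Q j) b j * Y j w))%R])%E =
    (\sum_(i | Q i) \sum_(j | Q j) a i * b j * c i j)%:E.
Proof.
move=> X2 Y2 XY.
have XY1 i j : Q i -> Q j -> X i * Y j \in Lfun P 1.
  by move=> Qi Qj; apply: Lfun2_mul_Lfun1; [exact: X2|exact: Y2].
pose Z (p : J * J) := (a p.1 * b p.2) \o* (X p.1 * Y p.2).
transitivity ('E_P[fun w => (\sum_(p | Q p.1 && Q p.2) Z p w)%R])%E.
  congr expectation; apply/funext => w.
  rewrite mulr_suml -(pair_big Q Q (fun i j => Z (i, j) w)) /=.
  apply: eq_bigr => i _; rewrite mulr_sumr; apply: eq_bigr => j _.
  rewrite /Z /= /GRing.mul /=; rewrite -![X in X = _]/((_ * _) * (_ * _)).
  by rewrite mulrACA mulrC.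
rewrite expectation_fin_sum; last first.
  by move=> p /andP[Q1 Q2]; apply: Lfun_scale => //; exact: XY1.
rewrite pair_big /= -sumEFin; apply: eq_bigr => p /andP[Q1 Q2].
by rewrite /Z expectationZl ?XY1// XY// EFinM.
Qed.

End second_moments.

Section expectation_ge0.
Context (R : realType) (d : measure_display) (T : measurableType d)
  (P : probability T R).

Lemma ge0_expectationD (X Y : T -> R) :
  measurable_fun setT X -> measurable_fun setT Y ->
  (forall w, 0 <= X w) -> (forall w, 0 <= Y w) ->
  ('E_P[fun w => (X w + Y w)%R] = 'E_P[X] + 'E_P[Y])%E.
Proof.
move=> mX mY X0 Y0; rewrite unlock.
under eq_integral do rewrite EFinD.
by rewrite ge0_integralD//;
  by [exact/measurable_EFinP | move=> w _; rewrite lee_fin].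
Qed.

Lemma ge0_expectationZ (X : T -> R) k : 0 <= k ->
  measurable_fun setT X -> (forall w, 0 <= X w) ->
  ('E_P[fun w => (k * X w)%R] = k%:E * 'E_P[X])%E.
Proof.
move=> k0 mX X0; rewrite unlock.
under eq_integral do rewrite EFinM.
by rewrite ge0_integralZl//;
  by [exact/measurable_EFinP | move=> w _; rewrite lee_fin].
Qed.

(** With [dlt] of the order of the root mean square of [X - Y], this bounds
    the second moment of [X] by that of [Y] up to a term of order [dlt]. *)
Lemma expectation_young (X Y : T -> R) dlt : 0 < dlt ->
  measurable_fun setT X -> measurable_fun setT Y ->
  ('E_P[fun w => (X w ^+ 2)%R] <= (1 + dlt)%:E * 'E_P[fun w => (Y w ^+ 2)%R] +
    (1 + dlt^-1)%:E * 'E_P[fun w => ((X w - Y w) ^+ 2)%R])%E.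
Proof.
move=> d0 mX mY.
have mX2 : measurable_fun setT (fun w => X w ^+ 2) by exact: measurable_funX.
have mY2 : measurable_fun setT (fun w => Y w ^+ 2) by exact: measurable_funX.
have mXY2 : measurable_fun setT (fun w => (X w - Y w) ^+ 2).
  by apply: measurable_funX; exact: measurable_funB.
have dV : 0 < dlt^-1 by rewrite invr_gt0.
have d1 : 0 <= 1 + dlt by rewrite addr_ge0// ltW.
have dV1 : 0 <= 1 + dlt^-1 by rewrite addr_ge0// ltW.
rewrite -!ge0_expectationZ//; try by move=> w; rewrite sqr_ge0.
have mU : measurable_fun setT (fun w => (1 + dlt) * Y w ^+ 2).
  exact: measurable_funM.
have mV : measurable_fun setT (fun w => (1 + dlt^-1) * (X w - Y w) ^+ 2).
  exact: measurable_funM.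
have U0 w : 0 <= (1 + dlt) * Y w ^+ 2 by rewrite mulr_ge0 ?sqr_ge0.
have V0 w : 0 <= (1 + dlt^-1) * (X w - Y w) ^+ 2 by rewrite mulr_ge0 ?sqr_ge0.
rewrite -ge0_expectationD//.
apply: expectation_le => //.
- exact: measurable_funD.
- by move=> w; rewrite sqr_ge0.
- by move=> w; rewrite addr_ge0.
apply: aeW => w; set a := X w; set b := Y w; rewrite -subr_ge0.
have -> : (1 + dlt) * b ^+ 2 + (1 + dlt^-1) * (a - b) ^+ 2 - a ^+ 2 =
    (dlt * b - (a - b)) ^+ 2 / dlt by field; rewrite gt_eqF.
by rewrite divr_ge0 ?sqr_ge0 ?ltW.
Qed.

End expectation_ge0.

Lemma ge0_expectation_sum (R : realType) (d : measure_display)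
    (T : measurableType d) (P : probability T R) (I : Type) (r : seq I)
    (Q : pred I) (X : I -> T -> R) :
  (forall i, measurable_fun setT (X i)) -> (forall i om, 0 <= X i om) ->
  ('E_P[fun om => (\sum_(i <- r | Q i) X i om)%R]
   = \sum_(i <- r | Q i) 'E_P[X i])%E.
Proof.
move=> mX X0; elim: r => [|i r IH].
  rewrite big_nil (_ : (fun om => _) = cst 0) ?expectation_cst//.
  by apply/funext => om; rewrite big_nil.
rewrite big_cons -IH; case: ifPn => Qi; last first.
  by congr expectation; apply/funext => om; rewrite big_cons (negPf Qi).
rewrite -ge0_expectationD//; first last.
- by move=> om; apply: sumr_ge0.
- under eq_fun do rewrite big_mkcond; apply: measurable_sum => j.
  by case: (Q j).
by congr expectation; apply/funext => om; rewrite big_cons Qi.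
Qed.

(** * Left-endpoint sums of a Wiener integral *)

Section wiener.
Context (R : realType) (d : measure_display) (T : measurableType d)
  (P : probability T R).

(** The second moments of a Wiener process of variance rate [q]. *)
Definition brownian_covariance (q : R) (b : R -> T -> R) : Prop :=
  (forall t, 0 <= t -> b t \in Lfun P 2%:E) /\
  (forall s t, 0 <= s -> 0 <= t ->
    ('E_P[(b s * b t)%R] = (q * Num.min s t)%:E)%E).

Variables (q : R) (b : R -> T -> R).
Hypothesis bq : brownian_covariance q b.

Lemma increment_Lfun2 s t : 0 <= s -> 0 <= t -> b t - b s \in Lfun P 2%:E.
Proof.
move=> s0 t0; have p1 : (1 <= 2%:E :> \bar R)%E by rewrite lee_fin ler1n.
apply: (Lfun_addr_closed P p1).2; first exact: bq.1.
by apply: (Lfun_oppr_closed (mu := P)); exact: bq.1.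
Qed.

Lemma increment_covariance t n k l : 0 <= t ->
  ('E_P[((b (grid t n k.+1) - b (grid t n k)) *
         (b (grid t n l.+1) - b (grid t n l)))%R]
   = (q * (t / n%:R) * (k == l)%:R)%:E)%E.
Proof.
move=> t0; set p := grid t n.
have p0 i : 0 <= p i by exact: grid_ge0.
have ple i j : (i <= j)%N -> p i <= p j by exact: grid_le.
pose X i (c : bool) := if c then b (p i.+1) else b (p i).
pose a (c : bool) : R := if c then 1 else -1.
have X2 i c : X i c \in Lfun P 2%:E by case: c; rewrite /X bq.1.
pose pp i (c : bool) := if c then p i.+1 else p i.
have := @expectation_bilinear _ _ _ P bool predT (X k) (X l) a a
  (fun c c' => q * Num.min (pp k c) (pp l c')).
move=> /(_ (fun c _ => X2 k c) (fun c _ => X2 l c)) bil.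
transitivity ('E_P[fun w => ((\sum_c a c * X k c w) * (\sum_c a c * X l c w))%R])%E.
  congr expectation; apply/funext => w; rewrite !big_bool /=.
  by rewrite !fctE !mul1r !mulN1r.
rewrite bil => [|c c' _ _]; last first.
  by rewrite /X /pp; case: c; case: c'; rewrite bq.2.
congr EFin; rewrite !big_bool /=.
have -> : t / n%:R = p k.+1 - p k by rewrite gridS.
case: (ltngtP k l) => [kl|lk|<-]; rewrite ?mulr0 ?mulr1.
- rewrite (min_l (ple _ _ (leqW kl))) (min_l (ple k.+1 l kl)).
  by rewrite (min_l (ple _ _ (leqW (ltnW kl)))) (min_l (ple _ _ (ltnW kl))); ring.
- rewrite (min_r (ple _ _ (leqW lk))) (min_r (ple l.+1 k lk)).
  by rewrite (min_r (ple _ _ (leqW (ltnW lk)))) (min_r (ple _ _ (ltnW lk))); ring.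
- rewrite !minxx (min_r (ple _ _ (leqnSn k))) (min_l (ple _ _ (leqnSn k))); ring.
Qed.

(** The Ito isometry for step functions: increments over distinct cells are
    uncorrelated. *)
Lemma increment_sum_isometry t n (a : nat -> R) : 0 <= t ->
  ('E_P[fun w => ((\sum_(0 <= k < n)
      a k * (b (grid t n k.+1) w - b (grid t n k) w)) ^+ 2)%R]
  = (q * (t / n%:R) * \sum_(0 <= k < n) a k ^+ 2)%:E)%E.
Proof.
move=> t0.
pose Z (k : 'I_n) := b (grid t n k.+1) - b (grid t n k).
have Z2 k : Z k \in Lfun P 2%:E by apply: increment_Lfun2; exact: grid_ge0.
have := @expectation_bilinear _ _ _ P 'I_n predT Z Z (fun k => a k) (fun k => a k)
  (fun k l => q * (t / n%:R) * (k == l)%:R) (fun k _ => Z2 k) (fun k _ => Z2 k).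
move=> bil.
under eq_fun do rewrite big_mkord expr2.
rewrite -[LHS]/('E_P[fun w => ((\sum_(k < n) a k * Z k w) * (\sum_(k < n) a k * Z k w))%R])%E.
rewrite bil => [|k l _ _]; last by rewrite /Z increment_covariance.
congr EFin; rewrite big_mkord mulr_sumr; apply: eq_bigr => k _.
rewrite (bigD1 k)//= eqxx big1 ?addr0 => [|l /negPf lk].
  by rewrite /= mulr1 -expr2 mulrC.
by rewrite eq_sym lk !mulr0.
Qed.

Lemma wiener_sum_measurable lam t n : 0 <= t ->
  measurable_fun setT (fun w => wiener_sum lam t (b ^~ w) n).
Proof.
move=> t0; apply: measurable_sum => k; apply: measurable_funM => //.
by apply: measurable_funB; apply: (@measurable_Lfun2 _ _ _ P); rewrite bq.1 ?grid_ge0.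
Qed.

End wiener.

(** A coarse increment is the sum of the [p] fine increments of its cell, so
    both sums become step integrals over one grid, to which the isometry
    applies. *)
Lemma wiener_sum_refine (R : realType) (lam t : R) (b : R -> R) m p :
  (0 < p)%N ->
  wiener_sum lam t b m = \sum_(0 <= l < m * p)
     expR (lam * grid t m (l %/ p) - lam * t) *
     (b (grid t (m * p) l.+1) - b (grid t (m * p) l)).
Proof.
move=> p0; rewrite big_nat_mul; apply: eq_bigr => k _.
have gridE j : grid t (m * p) (j * p) = grid t m j.
  rewrite /grid !natrM -mulf_div divff ?mulr1//.
  by rewrite pnatr_eq0 -lt0n.
rewrite -2!gridE -[in LHS](telescope_sumr (fun l => b (grid t (m * p) l))); last first.
  by rewrite leq_mul2r leqnSn orbT.
rewrite mulr_sumr !big_nat; apply: eq_bigr => l /andP[kl lk].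
have -> : (l %/ p)%N = k.
  apply/eqP; rewrite eqn_leq -ltnS ltn_divLR// lk andTb.
  by rewrite leq_divRL.
by rewrite gridE.
Qed.

(** Multiplied by [2 * lam], each term is at most the increment of
    [expR (2 * lam * (s - t))] over its cell and at least
    [expR (- (2 * lam * (t / n%:R)))] times it, both by [1 + u <= expR u]; the
    increments telescope. *)
Lemma exp_riemann_sum_bounds (R : realType) (lam t : R) n :
  0 < lam -> 0 <= t -> (0 < n)%N ->
  expR (- (2 * lam * (t / n%:R))) * ((1 - expR (- (2 * lam * t))) / (2 * lam))
    <= t / n%:R * \sum_(0 <= k < n) expR (lam * grid t n k - lam * t) ^+ 2
    <= (1 - expR (- (2 * lam * t))) / (2 * lam).
Proof.
move=> lam0 t0 n0; set h := t / n%:R; set s := h * _.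
pose G k := expR (2 * lam * (grid t n k - t)).
have l2 : 0 < 2 * lam by rewrite mulr_gt0.
have h0 : 0 <= h by rewrite divr_ge0.
have G0 k : 0 <= G k by exact: expR_ge0.
have tele : 1 - expR (- (2 * lam * t)) = \sum_(0 <= k < n) (G k.+1 - G k).
  rewrite telescope_sumr// /G gridn// grid0 subrr mulr0 expR0.
  by rewrite sub0r mulrN.
have GS k : G k.+1 = G k * expR (2 * lam * h).
  rewrite /G -expRD -mulrDr; congr (expR (_ * _)).
  by rewrite /h -(gridS t n k); ring.
have sE : s * (2 * lam) = \sum_(0 <= k < n) 2 * lam * h * G k.
  rewrite /s mulr_sumr mulr_suml; apply: eq_bigr => k _.
  have -> : expR (lam * grid t n k - lam * t) ^+ 2 = G k.
    by rewrite expr2 -expRD /G; congr expR; ring.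
  ring.
rewrite mulrA ler_pdivrMr// ler_pdivlMr// sE tele mulr_sumr.
apply/andP; split; rewrite big_nat [leRHS]big_nat; apply: ler_sum => k _.
  have -> : G k.+1 - G k = G k * (expR (2 * lam * h) - 1) by rewrite GS; ring.
  rewrite mulrCA [leRHS]mulrC ler_wpM2l// mulrBr mulr1 -expRD addNr expR0.
  by rewrite lerBlDr -lerBlDl expR_ge1Dx.
have -> : G k.+1 - G k = G k * (expR (2 * lam * h) - 1) by rewrite GS; ring.
by rewrite mulrC ler_wpM2l// lerBrDl expR_ge1Dx.
Qed.

Section wiener_estimates.
Context (R : realType) (d : measure_display) (T : measurableType d)
  (P : probability T R).
Variables (q : R) (b : R -> T -> R).
Hypotheses (q0 : 0 <= q) (bq : brownian_covariance P q b).

(** On the common grid the two integrands are values of a [lam]-Lipschitz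
    function at points at most [t / m] apart. *)
Lemma wiener_sum_refine_msq lam t m p : 0 < lam -> 0 <= t ->
  (0 < m)%N -> (0 < p)%N ->
  ('E_P[fun w => ((wiener_sum lam t (b ^~ w) (m * p)
                  - wiener_sum lam t (b ^~ w) m) ^+ 2)%R]
   <= (q * t * (lam * (t / m%:R)) ^+ 2)%:E)%E.
Proof.
move=> lam0 t0 m0 p0.
have mp0 : (0 < m * p)%N by rewrite muln_gt0 m0.
pose a l := expR (lam * grid t (m * p) l - lam * t) -
  expR (lam * grid t m (l %/ p) - lam * t).
rewrite [X in ('E_P[X] <= _)%E](_ : _ = fun w => (\sum_(0 <= l < m * p)
   a l * (b (grid t (m * p) l.+1) w - b (grid t (m * p) l) w)) ^+ 2); last first.
  apply/funext => w; rewrite (wiener_sum_refine lam t (b ^~ w) m p0) -sumrB.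
  by congr (_ ^+ 2); apply: eq_bigr => l _; rewrite mulrBl.
rewrite (increment_sum_isometry bq)// lee_fin -!mulrA ler_wpM2l//.
have aB l : (l < m * p)%N -> a l ^+ 2 <= (lam * (t / m%:R)) ^+ 2.
  move=> lmp.
  set u := grid t (m * p) l; set v := grid t m (l %/ p).
  have vE : v = grid t (m * p) (l %/ p * p).
    rewrite /v /grid !natrM -mulf_div divff ?mulr1// pnatr_eq0 -lt0n//.
  have vS : grid t m (l %/ p).+1 = grid t (m * p) ((l %/ p).+1 * p).
    rewrite /grid !natrM -mulf_div divff ?mulr1// pnatr_eq0 -lt0n//.
  have vu : v <= u by rewrite vE grid_le// leq_trunc_div.
  have uv : u - v <= t / m%:R.
    rewrite -(gridS t m (l %/ p)) lerD2r vS grid_le//.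
    by rewrite ltnW// -ltn_divLR.
  have ut : u <= t by rewrite -[leRHS](gridn t mp0) grid_le// ltnW.
  have a0 : 0 <= a l by rewrite subr_ge0 ler_expR lerD2r ler_wpM2l// ltW.
  have K0 : 0 <= lam * (t / m%:R) by rewrite mulr_ge0 ?divr_ge0// ltW.
  rewrite ler_pXn2r//.
  rewrite (@le_trans _ _ (lam * (u - v)))//; last by rewrite ler_wpM2l// ltW.
  have e1 : expR (lam * u - lam * t) <= 1.
    by rewrite -expR0 ler_expR -mulrBr pmulr_rle0// subr_le0.
  have x0 : 0 <= lam * (u - v) by rewrite mulr_ge0 ?subr_ge0 ?(ltW lam0).
  have -> : a l = expR (lam * u - lam * t) * (1 - expR (- (lam * (u - v)))).
    by rewrite mulrBr mulr1 -expRD /a -/u -/v; congr (_ - expR _); ring.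
  rewrite -[leRHS]mul1r ler_pM ?expR_ge0 ?subr_ge0//.
    by rewrite -expR0 ler_expR oppr_le0.
  by rewrite lerBlDr -lerBlDl expR_ge1Dx.
rewrite mulrA; set K := (lam * (t / m%:R)) ^+ 2 in aB *.
have -> : t * K = t / (m * p)%:R * \sum_(0 <= l < m * p) K.
  rewrite sumr_const_nat subn0 -(mulr_natr K).
  have : (m * p)%:R != 0 :> R by rewrite pnatr_eq0 -lt0n.
  by move: (m * p)%:R => N N0; field.
rewrite ler_wpM2l ?divr_ge0//.
by rewrite big_nat [leRHS]big_nat; apply: ler_sum => l /aB.
Qed.

(** The sums over the grids of [m * n.+1] cells are eventually within [D + e]
    of [Y] along almost every path, and within a bound uniform in [n] of the sum
    over [m] cells in mean square. Fatou's lemma is what allows the first,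
    non-uniform, approximation to be used under the expectation. *)
Lemma wiener_sum_msq_limit lam t m (Y D : T -> R) e :
  0 < lam -> 0 <= t -> (0 < m)%N -> 0 < e ->
  measurable_fun setT Y -> measurable_fun setT D ->
  {ae P, forall w, forall e, 0 < e -> exists N, forall n, (N <= n)%N ->
     `|Y w - wiener_sum lam t (b ^~ w) n| <= D w + e} ->
  ('E_P[fun w => ((Y w - wiener_sum lam t (b ^~ w) m) ^+ 2)%R]
   <= 2%:E * (q * t * (lam * (t / m%:R)) ^+ 2)%:E
     + 2%:E * 'E_P[fun w => ((D w + e) ^+ 2)%R])%E.
Proof.
move=> lam0 t0 m0 e0 mY mD YD.
pose W n w := wiener_sum lam t (b ^~ w) n.
have mW n : measurable_fun setT (W n) by exact: (wiener_sum_measurable bq).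
have mDe : measurable_fun setT (fun w => (D w + e) ^+ 2).
  by apply: measurable_funX; exact: measurable_funD.
have mWW n : measurable_fun setT (fun w => (W n w - W m w) ^+ 2).
  by apply: measurable_funX; exact: measurable_funB.
(* The sequence dominating [(Y - W m) ^+ 2], by [(u + v)^2 <= 2 u^2 + 2 v^2]
   applied to [Y - W (m * n.+1)] and [W (m * n.+1) - W m]. *)
pose Z n w := 2 * (W (m * n.+1)%N w - W m w) ^+ 2 + 2 * (D w + e) ^+ 2.
apply: (@expectation_fatou_le _ _ _ P _ Z).
- by apply: measurable_funX; exact: measurable_funB mY (mW m).
- by move=> w; rewrite sqr_ge0.
- by move=> n; apply: measurable_funD; exact: measurable_funM.
- by move=> n w; rewrite addr_ge0// mulr_ge0// sqr_ge0.
- apply: filterS YD => w /(_ e e0)[N YN]; exists N => n Nn.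
  have /YN : (N <= m * n.+1)%N.
    by rewrite (leq_trans Nn)// (leq_trans (leqnSn n))// leq_pmull.
  rewrite -/(W _ w) -/(W m w) /Z => YWD.
  have {}YWD : (Y w - W (m * n.+1)%N w) ^+ 2 <= (D w + e) ^+ 2.
    rewrite -[leLHS]real_normK ?num_real// ler_pXn2r ?nnegrE//.
    exact: le_trans YWD.
  apply: le_trans (_ : 2 * (W (m * n.+1)%N w - W m w) ^+ 2 +
    2 * (Y w - W (m * n.+1)%N w) ^+ 2 <= _); last by rewrite lerD2l ler_pM2l.
  move: (Y w) (W m w) (W (m * n.+1)%N w) => y a c.
  rewrite -subr_ge0 [leRHS](_ : _ = (c - a - (y - c)) ^+ 2) ?sqr_ge0//; ring.
- move=> n; rewrite /Z ge0_expectationD//; first last.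
  + by move=> w; rewrite mulr_ge0// sqr_ge0.
  + by move=> w; rewrite mulr_ge0// sqr_ge0.
  + exact: measurable_funM.
  + exact: measurable_funM.
  rewrite !ge0_expectationZ//; try by move=> w; rewrite sqr_ge0.
  rewrite leeD2r// lee_wpmul2l ?lee_fin//.
  exact: wiener_sum_refine_msq.
Qed.

(** [A] is the variance at time [t] of the Wiener integral. The grid is taken
    fine enough for the sum [W] to be within [dlt] of [Y] in mean square and for
    the second moment of [W] to lie between [(1 - dlt) * A] and [A]; Young's
    inequality with weight [dlt], used in both directions, transfers this
    to [Y]. *)
Lemma ornstein_uhlenbeck_estimate lam t (Y D : T -> R) e dlt :
  0 < lam -> 0 <= t -> 0 < e -> 0 < dlt ->
  measurable_fun setT Y -> measurable_fun setT D ->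
  {ae P, forall w, forall e, 0 < e -> exists N, forall n, (N <= n)%N ->
     `|Y w - wiener_sum lam t (b ^~ w) n| <= D w + e} ->
  ('E_P[fun w => ((D w + e) ^+ 2)%R] <= (dlt ^+ 2 / 4)%:E)%E ->
  let A := q * ((1 - expR (- (2 * lam * t))) / (2 * lam)) in
  exists2 u, 'E_P[fun w => (Y w ^+ 2)%R]%E = u%:E &
    u <= (1 + dlt) * A + (dlt + dlt ^+ 2) /\
    (1 - dlt) * A <= (1 + dlt) * u + (dlt + dlt ^+ 2).
Proof.
move=> lam0 t0 e0 dlt0 mY mD YD Dd A.
have A0 : 0 <= A.
  rewrite mulr_ge0// divr_ge0 ?mulr_ge0 ?(ltW lam0)//.
  by rewrite subr_ge0 -expR0 ler_expR oppr_le0 !mulr_ge0 ?(ltW lam0).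
have [m m0 [mq ml]] : exists2 m, (0 < m)%N &
    q * t * (lam * (t / m%:R)) ^+ 2 <= dlt ^+ 2 / 4 /\
    2 * lam * (t / m%:R) <= dlt.
  (* As [m <= m ^ 2], it suffices that [m] exceed both ratios [K] and [L]. *)
  pose K := q * t * (lam * t) ^+ 2 / (dlt ^+ 2 / 4).
  pose L := 2 * lam * t / dlt.
  have d24 : 0 < dlt ^+ 2 / 4 by rewrite divr_gt0 ?exprn_gt0.
  have K0 : 0 <= K.
    by apply: divr_ge0; [apply: mulr_ge0; [exact: mulr_ge0|exact: sqr_ge0]|exact: ltW].
  have L0 : 0 <= L.
    apply: divr_ge0; last exact: ltW.
    by apply: mulr_ge0 => //; apply: mulr_ge0 => //; exact: ltW.
  exists (Num.bound (K + L)).+1 => //; set m := (Num.bound (K + L)).+1.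
  have KLm : K + L <= m%:R.
    have KL0 : 0 <= K + L by exact: addr_ge0.
    by rewrite ltW// (lt_trans (archi_boundP KL0))// ltr_nat.
  have m0 : 0 < m%:R :> R by rewrite ltr0n.
  have m1 : 1 <= m%:R :> R by rewrite ler1n.
  have Km : K <= m%:R by rewrite (le_trans _ KLm)// lerDl.
  have Lm : L <= m%:R by rewrite (le_trans _ KLm)// lerDr.
  split; last by rewrite mulrA ler_pdivrMr// [leRHS]mulrC -ler_pdivrMr.
  rewrite mulrA expr_div_n mulrA ler_pdivrMr ?exprn_gt0// [leRHS]mulrC -ler_pdivrMr//.
  by rewrite (le_trans Km)// expr2 ler_peMl// ltW.
pose W w := wiener_sum lam t (b ^~ w) m.
have mW : measurable_fun setT W by exact: (wiener_sum_measurable bq).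
have YW : ('E_P[fun w => ((Y w - W w) ^+ 2)%R] <= (dlt ^+ 2)%:E)%E.
  apply: le_trans (wiener_sum_msq_limit lam0 t0 m0 e0 mY mD YD) _.
  apply: (@le_trans _ _ (2%:E * (dlt ^+ 2 / 4)%:E + 2%:E * (dlt ^+ 2 / 4)%:E)%E).
    by apply: leeD; rewrite lee_wpmul2l ?lee_fin.
  by rewrite -!EFinM -EFinD lee_fin; lra.
have WY : ('E_P[fun w => ((W w - Y w) ^+ 2)%R] <= (dlt ^+ 2)%:E)%E.
  rewrite (_ : (fun w => (W w - Y w) ^+ 2) = (fun w => (Y w - W w) ^+ 2))//.
  by apply/funext => w; rewrite -sqrrN opprB.
pose v := q * (t / m%:R) *
  \sum_(0 <= k < m) expR (lam * grid t m k - lam * t) ^+ 2.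
have EW : ('E_P[fun w => (W w ^+ 2)%R] = v%:E)%E.
  exact: (increment_sum_isometry bq).
have /andP[v1 v2] := exp_riemann_sum_bounds lam0 t0 m0.
have vA : v <= A by rewrite /v -mulrA ler_wpM2l.
have Av : (1 - dlt) * A <= v.
  rewrite /v -mulrA mulrCA ler_wpM2l// (le_trans _ v1)// ler_wpM2r//.
    rewrite divr_ge0 ?mulr_ge0 ?(ltW lam0)//.
    by rewrite subr_ge0 -expR0 ler_expR oppr_le0 !mulr_ge0 ?(ltW lam0).
  by rewrite (le_trans _ (expR_ge1Dx _))// lerD2l lerN2.
have d1 : 0 < 1 + dlt by rewrite addr_gt0.
have dV1 : 0 <= 1 + dlt^-1 by rewrite addr_ge0// invr_ge0 ltW.
have dd : (1 + dlt^-1) * dlt ^+ 2 = dlt + dlt ^+ 2 by field; rewrite gt_eqF.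
have up := expectation_young P dlt0 mY mW.
have lo := expectation_young P dlt0 mW mY.
have {}up : ('E_P[fun w => (Y w ^+ 2)%R] <=
    ((1 + dlt) * A + (dlt + dlt ^+ 2))%:E)%E.
  apply: (le_trans up); rewrite (EFinD ((1 + dlt) * A)); apply: leeD.
    by rewrite EW -EFinM lee_fin ler_wpM2l// ltW.
  by rewrite -dd EFinM lee_wpmul2l// lee_fin.
have {}lo : (((1 - dlt) * A)%:E <=
  (1 + dlt)%:E * 'E_P[fun w => (Y w ^+ 2)%R] + (dlt + dlt ^+ 2)%:E)%E.
  rewrite EW in lo; apply: (@le_trans _ _ v%:E); first by rewrite lee_fin.
  apply: (le_trans lo); rewrite leeD2l//.
  by rewrite -dd EFinM lee_wpmul2l// lee_fin.
have EY0 : (0 <= 'E_P[fun w => (Y w ^+ 2)%R])%E.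
  by apply: expectation_ge0 => w; rewrite sqr_ge0.
have EYfin : ('E_P[fun w => (Y w ^+ 2)%R])%E \is a fin_num.
  by rewrite ge0_fin_numE// (le_lt_trans up)// ltry.
exists (fine 'E_P[fun w => (Y w ^+ 2)%R]); first by rewrite fineK.
split; first by rewrite -lee_fin fineK.
by rewrite -lee_fin (EFinD ((1 + dlt) * _)) (EFinM (1 + dlt)) fineK.
Qed.

End wiener_estimates.

(** * A single mode of the network *)

Lemma within_continuous_lincomb (R : realType) (V : finType) (Q : pred V)
    (A : set R) (a : V -> R) (f : V -> R -> R) :
  (forall i, Q i -> {within A, continuous (f i)}) ->
  {within A, continuous (fun t => \sum_(i | Q i) a i * f i t)}.
Proof.
move=> cf x; apply: cvg_big => [|i Qi]; first exact: add_continuous.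
by apply: cvgM; [exact: cvg_cst|exact: cf].
Qed.

Lemma is_derive_lincomb (R : realType) (V : finType) (Q : pred V)
    (s : R) (a : V -> R) (f : V -> R -> R) (df : V -> R) :
  (forall i, Q i -> is_derive s (1 : R) (f i) (df i)) ->
  is_derive s (1 : R) (fun t => \sum_(i | Q i) a i * f i t)
    (\sum_(i | Q i) a i * df i).
Proof.
move=> dfE.
rewrite (_ : (fun t => _) = \sum_(i | Q i) (a i \*: f i)); last first.
  by apply/funext => t; rewrite fct_sumE.
elim/big_ind2: _ => [|g dg h dh Dg Dh|i Qi]; first exact: is_derive_cst.
  exact: is_deriveD.
by have := dfE i Qi => d; exact: is_deriveZ.
Qed.

(** Neither [f] nor [b] need be differentiable, but [f - b] is an integral of a
    continuous function. *)
Lemma integral_equation_derive (R : realType) (f F b : R -> R) (x0 : R) :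
  {within `[0, +oo[, continuous F} ->
  (forall t : R, 0 <= t ->
    f t = x0 + \int[lebesgue_measure]_(s in `[0, t]) F s + b t) ->
  forall s : R, 0 < s -> is_derive s (1 : R) (f - b) (F s).
Proof.
move=> cF fE s s0.
have s1 : s < s + 1 by rewrite ltrDl.
have cF1 : {within `[0, s + 1], continuous F}.
  by apply: continuous_subspaceW cF; exact: subset_itv0S.
have iF : lebesgue_measure.-integrable `[0, s + 1] (EFin \o F).
  apply: continuous_compact_integrable => //; exact: segment_compact.
have cFs : {for s, continuous F}.
  apply: (within_continuous_continuous _ cF1); last by rewrite in_itv/= s0.
  by rewrite (lt_trans s0).
have [dF F's] := continuous_FTC1_closed s1 iF s0 cFs.
have D : is_derive s (1 : R)
    (fun t => \int[lebesgue_measure]_(s in `[0, t]) F s) (F s).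
  by apply: DeriveDef; [exact: dF|rewrite -derive1E].
have := is_deriveD (is_derive_cst x0 s (1 : R)) D; rewrite add0r.
apply: near_eq_is_derive; near=> t.
rewrite !fctE /= fE ?addrK//.
by apply/ltW; near: t; exact: lt_nbhsr.
Unshelve. all: by end_near. Qed.

(** Pairing the follower equations with an eigenvector closes them: by symmetry
    of the Laplacian the drift of [y] is [- lam * y] plus an input [c] that
    involves the leaders alone, and these decay at rates at least [mu]. Since
    [lam] may coincide with a rate of the leaders, the decaying input can
    produce a response as large as [t * expR (- (mu * t))]. *)
Lemma mode_path_approx (R : realType) (V : finType) (E : rel V)
    (w : V -> V -> R) (S : {set V}) (kappa : V -> R) (lam mu : R)
    (phi : V -> R) (x b : V -> R -> R) :
  is_network E w ->
  0 < lam -> mu <= lam -> (forall i, i \in S -> mu <= kappa i) ->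
  (forall j, j \in S -> phi j = 0) ->
  (forall k, k \notin S -> laplacian w phi k = lam * phi k) ->
  (forall i, {within `[0, +oo[, continuous (x i)}) ->
  (forall i, i \notin S -> {within `[0, +oo[, continuous (b i)}) ->
  (forall i, i \in S -> forall t : R, 0 < t ->
     is_derive t (1 : R) (x i) (- kappa i * x i t)) ->
  (forall i, i \notin S -> forall t : R, 0 <= t -> x i t = x i 0 +
     \int[lebesgue_measure]_(s in `[0, t])
        (- \sum_(j | E i j) w i j * (x i s - x j s)) + b i t) ->
  forall t : R, 0 < t -> forall e : R, 0 < e -> exists N, forall n, (N <= n)%N ->
    `|\sum_i phi i * x i t -
      wiener_sum lam t (fun s => \sum_(i | i \notin S) phi i * b i s) n|
    <= (1 + t) * expR (- (mu * t)) *
         (\sum_i (`|phi i| + `|laplacian w phi i|) * `|x i 0|) + e.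
Proof.
move=> hG lam0 mul muk phiS phiL cx cb leader follower t t0 e e0.
pose y s := \sum_i phi i * x i s.
pose be s := \sum_(i | i \notin S) phi i * b i s.
pose c s := - \sum_(i in S) laplacian w phi i * x i s.
have wt : forall i s, \sum_(j | E i j) w i j * (x i s - x j s) =
    laplacian w (x^~ s) i by move=> i s; rewrite sum_edges.
have yE s : y s = \sum_(i | i \notin S) phi i * x i s.
  rewrite /y (bigID (mem S))/= big1 ?add0r// => i iS.
  by rewrite phiS// mul0r.
have cy : {within `[0, +oo[, continuous y}.
  by apply: (within_continuous_lincomb (Q := predT)) => i _; exact: cx.
have cbe : {within `[0, +oo[, continuous be} by exact: within_continuous_lincomb.
have dy (s : R) : 0 < s -> is_derive s (1 : R) (y - be) (c s - lam * y s).
  move=> s0.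
  have -> : y - be = fun s => \sum_(i | i \notin S) phi i * (x i - b i) s.
    apply/funext => r; rewrite !fctE yE /be -sumrB.
    by apply: eq_bigr => i _; rewrite mulrBr.
  have -> : c s - lam * y s =
      \sum_(i | i \notin S) phi i * - laplacian w (x^~ s) i.
    have -> : \sum_(i | i \notin S) phi i * - laplacian w (x^~ s) i =
        - \sum_i phi i * laplacian w (x^~ s) i.
      rewrite [in RHS](bigID (mem S))/= [X in - (X + _)]big1 ?add0r => [|i iS]; last first.
        by rewrite phiS// mul0r.
      by rewrite -sumrN; apply: eq_bigr => i _; rewrite mulrN.
    rewrite laplacian_sym; last exact: weight_sym hG.
    rewrite [in RHS](bigID (mem S))/= opprD; congr (_ - _).
    rewrite yE mulr_sumr; apply: eq_bigr => i iS.
    by rewrite phiL// mulrA.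
  apply: is_derive_lincomb => i iS.
  apply: (@integral_equation_derive _ (x i)
    (fun s => - laplacian w (x^~ s) i) (b i) (x i 0)) => //.
    move=> r; apply: cvgN; apply: (within_continuous_lincomb (Q := predT)) => j _ r'.
    by apply: cvgB; exact: cx.
  move=> r r0; rewrite follower//; congr (_ + _ + _).
  by apply: eq_Rintegral => u _; rewrite wt.
pose C := \sum_(i in S) `|laplacian w phi i| * `|x i 0|.
have C0 : 0 <= C by apply: sumr_ge0 => i _; rewrite mulr_ge0.
have cM (s : R) : 0 < s < t -> expR (lam * s - lam * t) * `|c s| <= expR (- (mu * t)) * C.
  move=> /andP[s0 st].
  have cC : `|c s| <= expR (- (mu * s)) * C.
    rewrite normrN (le_trans (ler_norm_sum _ _ _))// mulr_sumr.
    apply: ler_sum => i iS.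
    rewrite (exp_decay (cx i) (leader i iS) (ltW s0)) !normrM mulrCA.
    rewrite ler_wpM2r ?mulr_ge0// ger0_norm ?expR_ge0// ler_expR lerN2.
    by rewrite ler_wpM2r ?(ltW s0)// muk.
  apply: le_trans (ler_wpM2l (expR_ge0 _) cC) _.
  rewrite mulrA -expRD ler_wpM2r// ler_expR.
  rewrite -subr_ge0 [leRHS](_ : _ = (lam - mu) * (t - s)); last by ring.
  by rewrite mulr_ge0// subr_ge0// ltW.
have [N NP] := path_approx lam0 t0 cy cbe dy cM e0.
exists N => n /NP {}NP.
pose Y0 := \sum_i `|phi i| * `|x i 0|.
have y0 : `|expR (- (lam * t)) * y 0| <= expR (- (mu * t)) * Y0.
  rewrite normrM ger0_norm ?expR_ge0// ler_pM ?expR_ge0//.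
    by rewrite ler_expR lerN2 ler_wpM2r// ltW.
  rewrite (le_trans (ler_norm_sum _ _ _))//.
  by apply: ler_sum => i _; rewrite normrM.
have Y00 : 0 <= Y0 by apply: sumr_ge0 => i _; rewrite mulr_ge0.
pose C1 := \sum_i `|laplacian w phi i| * `|x i 0|.
have CC1 : C <= C1.
  rewrite /C1 (bigID (mem S))/= lerDl; apply: sumr_ge0 => i _.
  by rewrite mulr_ge0.
have -> : \sum_i (`|phi i| + `|laplacian w phi i|) * `|x i 0| = Y0 + C1.
  by rewrite -big_split; apply: eq_bigr => i _; rewrite mulrDl.
rewrite -/(y t) -/be.
have ex0 : 0 <= expR (- (mu * t)) by exact: expR_ge0.
apply: (@le_trans _ _ (expR (- (mu * t)) * Y0 + (t * (expR (- (mu * t)) * C) + e))).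
  rewrite -[X in `|X|](subrK (expR (- (lam * t)) * y 0)) addrC.
  rewrite (le_trans (ler_normD _ _))// lerD//.
  by move: NP; rewrite addrAC.
rewrite addrA lerD2r.
have H1 : expR (- (mu * t)) * Y0 <= (1 + t) * expR (- (mu * t)) * Y0.
  by rewrite ler_wpM2r// ler_peMl// lerDl ltW.
have H2 : t * (expR (- (mu * t)) * C) <= (1 + t) * expR (- (mu * t)) * C1.
  rewrite mulrA ler_pM ?mulr_ge0 ?(ltW t0)//.
  by rewrite ler_wpM2r// lerDr.
by rewrite mulrDr lerD.
Qed.

Lemma white_noise_moments (R : realType) (d : measure_display)
    (T : measurableType d) (P : probability T R) (V : finType) (F : {set V})
    (B : V -> R -> {RV P >-> R}) i j (s t : R) :
  is_integrated_white_noise P F B -> i \in F -> j \in F -> 0 <= s -> 0 <= t ->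
  ('E_P[((B i s : T -> R) * (B j t : T -> R))%R] =
    (if i == j then Num.min s t else 0)%:E)%E.
Proof.
move=> hB iF jF s0 t0; rewrite -(noise_covariance hB iF jF s0 t0).
rewrite covariance.unlock !(noise_mean hB)//=; congr expectation.
by apply/funext => w; rewrite !fctE /= !subr0.
Qed.

Lemma mode_noise_covariance (R : realType) (d : measure_display)
    (T : measurableType d) (P : probability T R) (V : finType) (S : {set V})
    (B : V -> R -> {RV P >-> R}) (phi : V -> R) :
  is_integrated_white_noise P (~: S)%SET B ->
  brownian_covariance P (\sum_(i | i \notin S) phi i ^+ 2)
    (fun t w => \sum_(i | i \notin S) phi i * B i t w).
Proof.
move=> hB.
have B2 i t : i \notin S -> 0 <= t -> (B i t : T -> R) \in Lfun P 2%:E.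
  move=> iS t0; apply: Lfun2_sqr_lty => //.
  have iF : i \in (~: S)%SET by rewrite inE.
  have := white_noise_moments hB iF iF t0 t0; rewrite eqxx minxx => /= BE.
  rewrite [X in 'E__[X]%E](_ : _ = (B i t : T -> R) * (B i t : T -> R)).
    by rewrite BE ltry.
  by apply/funext => w; rewrite expr2.
split=> [t t0|s t s0 t0].
  have p1 : (1 <= 2%:E :> \bar R)%E by rewrite lee_fin ler1n.
  rewrite (_ : (fun w => _) = \sum_(i | i \notin S) (fun w => phi i * B i t w)).
    have [L0 LD] := Lfun_addr_closed P p1.
    apply: (big_ind (fun X => X \in Lfun P 2%:E)) => [//|X Y X2 Y2|i iS].
      exact: LD.
    rewrite (_ : (fun w => phi i * B i t w) = phi i \o* (B i t : T -> R)).
      by apply: Lfun_scale; [exact: ler1n|exact: B2].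
    by apply/funext => w /=; rewrite mulrC.
  by apply/funext => w; rewrite fct_sumE.
have := @expectation_bilinear _ _ _ P V (fun i => i \notin S)
  (fun i => B i s) (fun i => B i t) phi phi
  (fun i j => if i == j then Num.min s t else 0)
  (fun i iS => B2 i s iS s0) (fun i iS => B2 i t iS t0).
move=> bil; rewrite [LHS]bil => [|i j iS jS]; last first.
  by apply: (white_noise_moments hB); rewrite ?inE.
congr EFin; rewrite mulr_suml; apply: eq_bigr => i iS.
rewrite (bigD1 i)//= eqxx big1 ?addr0 ?expr2// => j /andP[_ /negPf ji].
by rewrite eq_sym ji mulr0.
Qed.

Lemma cvgr_expRM (R : realType) (a : R) : 0 < a ->
  expR (- (a * t)) @[t --> +oo] --> (0 : R).
Proof.
move=> a0; apply: (cvg_comp (fun t : R => a * t) (fun x => expR (- x))).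
  by apply: gt0_cvgMry => //; exact: cvg_id.
exact: cvgr_expR.
Qed.

(** [mu] is the slowest rate among [lam] and the [kappa i]. The error terms of
    [mode_path_approx] are bounded by [rho t] times a square integrable variable
    independent of [t], and [ornstein_uhlenbeck_estimate] with [dlt] proportional
    to [rho] squeezes the second moment between two functions with limit
    [q / (2 * lam)]. *)
Lemma mode_second_moment (R : realType) (V : finType) (E : rel V)
    (w : V -> V -> R)
    (S : {set V}) (kappa : V -> R)
    (d : measure_display) (T : measurableType d) (P : probability T R)
    (B x : V -> R -> {RV P >-> R}) (lam : R) (phi : V -> R) :
  is_network E w ->
  is_noise_free_leader_dynamics P E w S kappa B x ->
  0 < lam ->
  (forall j, j \in S -> phi j = 0) ->
  (forall k, k \notin S -> laplacian w phi k = lam * phi k) ->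
  ('E_P[fun om => ((\sum_i phi i * x i t om) ^+ 2)%R])%E @[t --> +oo] -->
    ((\sum_i phi i ^+ 2) / (2 * lam))%:E.
Proof.
move=> hG hx lam0 phiS phiL.
pose q := \sum_(i | i \notin S) phi i ^+ 2.
have -> : \sum_i phi i ^+ 2 = q.
  rewrite (bigID (mem S))/= big1 ?add0r// => i iS.
  by rewrite phiS// expr0n.
have q0 : 0 <= q by apply: sumr_ge0 => i _; rewrite sqr_ge0.
pose be t om := \sum_(i | i \notin S) phi i * B i t om.
have beq : brownian_covariance P q be := mode_noise_covariance phi (dynamics_noise hx).
pose Y t om := \sum_i phi i * x i t om.
have mY t : measurable_fun setT (Y t).
  by apply: measurable_sum => i; apply: measurable_funM.
pose mu := \big[Num.min/lam]_(i in S) kappa i.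
have mu0 : 0 < mu.
  by apply: lt_bigmin => // i iS; exact: (leader_rate_gt0 hx).
have mul : mu <= lam by exact: bigmin_le_id.
have muk i : i \in S -> mu <= kappa i by exact: bigmin_le_cond.
(* Half of the rate [mu] is spent on absorbing the factor [1 + t]. *)
pose a := mu / 2.
have a0 : 0 < a by rewrite divr_gt0.
have aV0 : 0 < a^-1 by rewrite invr_gt0.
pose rho t := (1 + a^-1) * expR (- (a * t)).
have rho0 t : 0 < rho t by rewrite mulr_gt0 ?expR_gt0// addr_gt0.
have rhoP t : 0 <= t -> (1 + t) * expR (- (mu * t)) <= rho t.
  move=> t0; have -> : - (mu * t) = a * t * -1 + - (a * t) by rewrite /a; field.
  rewrite mulrN1 expRD mulrA ler_wpM2r ?expR_ge0//.
  rewrite expRN ler_pdivrMr ?expR_gt0//.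
  apply: (@le_trans _ _ ((1 + a^-1) * (1 + a * t))).
    rewrite -subr_ge0 [leRHS](_ : _ = a^-1 + a * t); last first.
      by field; rewrite gt_eqF.
    by apply: addr_ge0; [exact: ltW|apply: mulr_ge0 => //; exact: ltW].
  by rewrite ler_wpM2l ?expR_ge1Dx// addr_ge0// ltW.
pose G om := \sum_i (`|phi i| + `|laplacian w phi i|) * `|x i 0 om|.
have G2 : (fun om => G om + 1) \in Lfun P 2%:E.
  have xi2 i : (fun om => (`|phi i| + `|laplacian w phi i|) * `|x i 0 om|)
      \in Lfun P 2%:E.
    rewrite (_ : (fun om => _) = (`|phi i| + `|laplacian w phi i|) \o*
        (fun om => `|x i 0 om|)); last first.
      by apply/funext => om /=; rewrite mulrC.
    apply: Lfun_scale; first exact: ler1n.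
    apply: Lfun2_sqr_lty; first exact: measurableT_comp.
    rewrite (_ : (fun om => _) = (fun om => x i 0 om ^+ 2)).
      exact: initial_second_moment hx i.
    by apply/funext => om; rewrite real_normK// num_real.
  have p1 : (1 <= 2%:E :> \bar R)%E by rewrite lee_fin ler1n.
  have [L0 LD] := Lfun_addr_closed P p1.
  rewrite (_ : (fun om => _) = G + cst 1)//; apply: (LD); last exact: Lfun_cst.
  rewrite (_ : G = \sum_i (fun om =>
      (`|phi i| + `|laplacian w phi i|) * `|x i 0 om|)); last first.
    by apply/funext => om; rewrite fct_sumE.
  by apply: (big_ind (fun X => X \in Lfun P 2%:E)).
have mG : measurable_fun setT G.
  by apply: measurable_sum => i; apply: measurable_funM => //; exact: measurableT_comp.
pose K := fine 'E_P[fun om => ((G om + 1) ^+ 2)%R].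
have K0 : 0 <= K.
  by rewrite fine_ge0//; apply: expectation_ge0 => om; rewrite sqr_ge0.
have EK : 'E_P[fun om => ((G om + 1) ^+ 2)%R]%E = K%:E.
  rewrite fineK//; apply: expectation_fin_num; apply/Lfun1_integrable.
  exact: Lfun2_integrable_sqr G2.
pose k := 2 * (K + 1).
have k0 : 0 < k by rewrite mulr_gt0// ltr_wpDl.
pose dlt t := k * rho t.
have dlt0 t : 0 < dlt t by rewrite mulr_gt0.
have path : {ae P, forall om, forall t : R, 0 < t -> forall e : R, 0 < e ->
  exists N, forall n, (N <= n)%N ->
    `|Y t om - wiener_sum lam t (be ^~ om) n| <= rho t * G om + e}.
  have ae_x : {ae P, forall om, forall i,
      {within `[0, +oo[, continuous (fun t : R => x i t om : R)}}.
    by apply: filter_forall => i; exact: state_continuous hx i.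
  have ae_b : {ae P, forall om, forall i, i \notin S ->
      {within `[0, +oo[, continuous (fun t : R => B i t om : R)}}.
    apply: filter_forall => i; have [iS|iS] := boolP (i \in S).
      exact: aeW.
    have iF : i \in (~: S)%SET by rewrite inE.
    by apply: filterS (noise_continuous (dynamics_noise hx) iF) => om.
  have ae_l : {ae P, forall om, forall i, i \in S -> forall t : R, 0 < t ->
      is_derive t (1 : R) (fun s : R => x i s om : R) (- kappa i * x i t om)}.
    apply: filter_forall => i; have [iS|iS] := boolP (i \in S); last first.
      exact: aeW.
    by apply: filterS (leader_equation hx iS) => om.
  have ae_f : {ae P, forall om, forall i, i \notin S -> forall t : R, 0 <= t ->
      x i t om = x i 0 om
        + \int[lebesgue_measure]_(s in `[0, t])
            (- \sum_(j | E i j) w i j * (x i s om - x j s om))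
        + B i t om}.
    apply: filter_forall => i; have [iS|iS] := boolP (i \in S).
      exact: aeW.
    by apply: filterS (follower_equation hx iS) => om.
  apply: filterS2 (filterI ae_x ae_b) (filterI ae_l ae_f) => om [cx cb] [le fe].
  move=> t t0 e e0.
  have [N NP] := mode_path_approx hG lam0 mul muk phiS phiL cx cb le fe t0 e0.
  exists N => n /NP /le_trans; apply; rewrite lerD2r ler_wpM2r//.
    by apply: sumr_ge0 => i _; rewrite mulr_ge0// addr_ge0.
  exact/rhoP/ltW.
pose A t := q * ((1 - expR (- (2 * lam * t))) / (2 * lam)).
have est t : 0 < t -> exists2 u, 'E_P[fun om => (Y t om ^+ 2)%R]%E = u%:E &
    u <= (1 + dlt t) * A t + (dlt t + dlt t ^+ 2) /\
    (1 - dlt t) * A t <= (1 + dlt t) * u + (dlt t + dlt t ^+ 2).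
  move=> t0.
  apply: (ornstein_uhlenbeck_estimate q0 beq lam0 (ltW t0) (rho0 t) (dlt0 t)
    (mY t) (D := fun om => rho t * G om)).
  - exact: measurable_funM.
  - by apply: filterS path => om /(_ t t0).
  - rewrite [X in 'E_P[X]%E](_ : _ = fun om => rho t ^+ 2 * (G om + 1) ^+ 2).
      rewrite ge0_expectationZ ?sqr_ge0//; first last.
      - by move=> om; rewrite sqr_ge0.
      - by apply: measurable_funX; exact: measurable_funD.
      rewrite EK -EFinM lee_fin.
      have -> : dlt t ^+ 2 / 4 = rho t ^+ 2 * (K + 1) ^+ 2.
        by rewrite /dlt /k; field.
      rewrite ler_wpM2l ?sqr_ge0// -subr_ge0.
      have -> : (K + 1) ^+ 2 - K = K ^+ 2 + K + 1 by ring.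
      by rewrite !addr_ge0 ?sqr_ge0.
    by apply/funext => om; rewrite -exprMn mulrDr mulr1.
have dltc : dlt t @[t --> +oo] --> (0 : R).
  rewrite -(mulr0 k); apply: cvgM; first exact: cvg_cst.
  rewrite -(mulr0 (1 + a^-1)); apply: cvgM; first exact: cvg_cst.
  exact: cvgr_expRM.
have Ac : A t @[t --> +oo] --> q / (2 * lam).
  rewrite -[X in _ --> q * X]mul1r -{1}(subr0 1).
  apply: cvgM; first exact: cvg_cst.
  apply: cvgM; last exact: cvg_cst.
  apply: cvgB; first exact: cvg_cst.
  by apply: cvgr_expRM; rewrite mulr_gt0.
have d2c : dlt t + dlt t ^+ 2 @[t --> +oo] --> (0 : R).
  rewrite -(addr0 0) -{2}(mulr0 0).
  under eq_fun do rewrite expr2.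
  by apply: cvgD => //; apply: cvgM.
have d1c : 1 + dlt t @[t --> +oo] --> (1 : R).
  by rewrite -[X in _ --> X](addr0 1); apply: cvgD => //; exact: cvg_cst.
have d1mc : 1 - dlt t @[t --> +oo] --> (1 : R).
  by rewrite -[X in _ --> X](subr0 1); apply: cvgB => //; exact: cvg_cst.
apply: cvg_EFin.
  near=> t.
  have [|u -> //] := est t.
  by near: t; exact: nbhs_pinfty_gt.
apply: (squeeze_cvgr
  (f := fun t => ((1 - dlt t) * A t - (dlt t + dlt t ^+ 2)) / (1 + dlt t))
  (h := fun t => (1 + dlt t) * A t + (dlt t + dlt t ^+ 2))).
- near=> t.
  have [|u uE [u1 u2]] := est t.
    by near: t; exact: nbhs_pinfty_gt.
  rewrite /= -/(Y t) uE /= u1 andbT ler_pdivrMr ?addr_gt0//.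
  by rewrite lerBlDr [u * _]mulrC.
- have -> : q / (2 * lam) = (1 * (q / (2 * lam)) - 0) / 1.
    by rewrite divr1 subr0 mul1r.
  apply: cvgM; last by apply: cvgV => //; exact: oner_neq0.
  by apply: cvgB => //; apply: cvgM.
- have -> : q / (2 * lam) = 1 * (q / (2 * lam)) + 0 by rewrite addr0 mul1r.
  by apply: cvgD => //; apply: cvgM.
Unshelve. all: by end_near. Qed.

(** * Coherence *)

(** Parseval's identity for the frame [phi], under the expectation. *)
Lemma total_follower_variance_modes (R : realType) (d : measure_display)
    (T : measurableType d) (P : probability T R) (V : finType) (S : {set V})
    (x : V -> R -> {RV P >-> R}) (I : finType) (phi : I -> V -> R) t :
  (forall m j, j \in S -> phi m j = 0) ->
  (forall i j, i \notin S -> j \notin S ->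
     \sum_m phi m i * phi m j = (i == j)%:R) ->
  total_follower_variance P S x t =
  (\sum_m 'E_P[fun om => ((\sum_i phi m i * x i t om) ^+ 2)%R])%E.
Proof.
move=> phiS phi1.
have parseval (z : V -> R) : \sum_(i | i \notin S) z i ^+ 2 =
    \sum_m (\sum_i phi m i * z i) ^+ 2.
  transitivity (\sum_m \sum_(i | i \notin S) \sum_(j | j \notin S)
      phi m i * phi m j * (z i * z j)).
    rewrite exchange_big; apply: eq_bigr => i iS /=.
    rewrite exchange_big (bigD1 i)//= [X in _ + X]big1 => [|j /andP[jS ji]].
      by rewrite -mulr_suml phi1// eqxx mul1r addr0 expr2.
    by rewrite -mulr_suml phi1// eq_sym (negPf ji) mul0r.
  apply: eq_bigr => m _.
  have -> : \sum_i phi m i * z i = \sum_(i | i \notin S) phi m i * z i.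
    rewrite (bigID (mem S))/= big1 ?add0r// => i iS.
    by rewrite phiS// mul0r.
  rewrite expr2 mulr_suml; apply: eq_bigr => i _.
  by rewrite mulr_sumr; apply: eq_bigr => j _; rewrite mulrACA.
rewrite -ge0_expectation_sum; last 2 first.
- move=> m; apply: measurable_funX; apply: measurable_sum => i.
  exact: measurable_funM.
- by move=> m om; exact: sqr_ge0.
rewrite /total_follower_variance -ge0_expectation_sum; last 2 first.
- by move=> i; exact: measurable_funX.
- by move=> i om; exact: sqr_ge0.
by congr expectation; apply/funext => om; exact: parseval.
Qed.

Theorem theorem2 (R : realType) (V : finType) (E : rel V) (w : V -> V -> R)
    (S : {set V}) (kappa : V -> R)
    (d : measure_display) (T : measurableType d) (P : probability T R)
    (B x : V -> R -> {RV P >-> R})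
    (hG : is_network E w) (hS : S != finset.set0)
    (hx : is_noise_free_leader_dynamics P E w S kappa B x) :
  cvg (total_follower_variance P S x t @[t --> +oo]) /\
  coherence P S x =
    (1 / 2 * \sum_(i | i \notin S) effective_resistance E w S i)%:E.
Proof.
have [I [lam [phi [lam0 phiS phiL phi1]]]] := follower_modes hG hS.
suff h : total_follower_variance P S x t @[t --> +oo] -->
    (1 / 2 * \sum_(i | i \notin S) effective_resistance E w S i)%:E.
  by split; [apply/cvg_ex; exists (1 / 2 *
    \sum_(i | i \notin S) effective_resistance E w S i)%:E|exact: cvg_lim].
have -> : 1 / 2 * \sum_(i | i \notin S) effective_resistance E w S i =
    \sum_m (\sum_i phi m i ^+ 2) / (2 * lam m).
  have lamN0 m : lam m != 0 by rewrite gt_eqF.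
  under eq_bigr => i iS do
    rewrite (effective_resistance_modes hG hS lamN0 phiS phiL phi1 iS).
  rewrite exchange_big mulr_sumr; apply: eq_bigr => m _ /=.
  rewrite [in RHS](bigID (mem S))/= [X in (X + _) / _]big1 ?add0r => [|i iS].
    by rewrite -mulr_suml; field.
  by rewrite phiS// expr0n.
have -> : total_follower_variance P S x = fun t =>
    (\sum_m 'E_P[fun om => ((\sum_i phi m i * x i t om) ^+ 2)%R])%E.
  by apply/funext => t; exact: total_follower_variance_modes.
rewrite -sumEFin; apply: cvg_nnesum => m _.
  by apply: nearW => t; apply: expectation_ge0 => om; exact: sqr_ge0.
exact: mode_second_moment hG hx (lam0 m) (phiS m) (phiL m).
Qed.
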